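(* Let $X$ be an $n$-dimensional real polygonal Banach space and let $Y$ be any real normed linear space. Let $T \in L(X,Y)$ be an extreme contraction. Then $\operatorname{span}(M_T \cap E_X) = X$. Moreover, if $M_T \cap E_X$ contains exactly $2n$ elements, then $T(M_T \cap E_X) \subset E_Y$.
   Context: All spaces are real. For a normed space $Z$, $B_Z=\{z\in Z:\|z\|\le 1\}$ and $S_Z=\{z\in Z:\|z\|=1\}$ are the unit ball and unit sphere, and $E_Z$ is the set of all extreme points of $B_Z$. A finite-dimensional Banach space $X$ is called polygonal if $B_X$ has only finitely many extreme points (equivalently, $S_X$ is a polytope). $L(X,Y)$ is the space of all bounded linear operators from $X$ to $Y$ with the usual operator norm. An operator $T\in L(X,Y)$ is an extreme contraction if it is an extreme point of the unit ball $B_{L(X,Y)}$. For $T\in L(X,Y)$, the norm attainment set is $M_T=\{x\in S_X:\|Tx\|=\|T\|\}$. *)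

(* Defs.v *)
From HB Require Import structures.
From mathcomp Require Import all_boot all_order all_algebra.
From mathcomp Require Import all_classical all_reals topology normedtype sequences.

Set Implicit Arguments.
Unset Strict Implicit.
Unset Printing Implicit Defensive.

Import Order.TTheory GRing.Theory Num.Theory.
Import numFieldNormedType.Exports.

Local Open Scope classical_set_scope.
Local Open Scope ring_scope.

(* Finite-dimensional Banach spaces: the norm and the vectType structure share
   the same underlying R-module, and no norm is singled out. *)
#[short(type="finDimBanachType")]
HB.structure Definition FinDimBanach (R : realType) :=
  {V of CompleteNormedModule R V & Vector R V}.

Definition unit_ball {R : realType} (Z : normedModType R) : set Z :=
  [set z | `|z| <= 1].
Arguments unit_ball {R} Z.

Definition unit_sphere {R : realType} (Z : normedModType R) : set Z :=
  [set z | `|z| = 1].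
Arguments unit_sphere {R} Z.

Definition extreme_points (R : realType) (V : lmodType R) (A : set V) : set V :=
  [set x | A x /\
    forall (y z : V) (t : R), A y -> A z -> 0 < t < 1 ->
      x = t *: y + (1 - t) *: z -> y = x /\ z = x].

Definition ball_extreme_points {R : realType} (Z : normedModType R) : set Z :=
  extreme_points (unit_ball Z).
Arguments ball_extreme_points {R} Z.

Definition polygonal (R : realType) (X : finDimBanachType R) : Prop :=
  finite_set (ball_extreme_points X).

Definition bounded_linear_operators (R : realType) (X Y : normedModType R) :
    set (X -> Y) :=
  [set T | linear T /\ bounded_fun_norm T].

(* The supremum is taken in R: it is meaningful for bounded T only. *)
Definition operator_norm (R : realType) (X Y : normedModType R)
    (T : X -> Y) : R :=
  sup [set `|T x| | x in unit_ball X].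

Definition operator_unit_ball (R : realType) (X Y : normedModType R) :
    set (X -> Y) :=
  [set T | bounded_linear_operators T /\ operator_norm T <= 1].

(* Extreme points are computed in the lmodType of all functions X -> Y, of
   which the bounded linear operators form a submodule. *)
Definition extreme_contraction (R : realType) (X Y : normedModType R)
    (T : X -> Y) : Prop :=
  extreme_points (@operator_unit_ball R X Y) T.

Definition norm_attainment_set (R : realType) (X Y : normedModType R)
    (T : X -> Y) : set X :=
  [set x | unit_sphere X x /\ `|T x| = operator_norm T].

Definition linear_span (R : realType) (V : vectType R) (A : set V) : set V :=
  [set v | exists2 s : seq V, [set` s] `<=` A & v \in span s].

(* Main.v *)
(* A linear map on X bounded by M at the extreme points of the ball is bounded
   by M on the ball: the norm of its value is a continuous convex function, so
   by Bauer's maximum principle it is maximal at an extreme point. As X has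
   finitely many extreme points, an extreme contraction T is therefore rigid:
   if a linear S satisfies |T x +- e S x| <= 1 for some e > 0 at each extreme
   point x where T attains its norm, then T +- e S are contractions for small
   e, so S = 0. If the attaining extreme points do not span X, take S = f(.) y
   with f vanishing on them. If there are exactly 2n of them, they are +-x_i for
   a basis x_1, ..., x_n; when T x_1 lies inside a segment [y, z] of the ball,
   take S = f(.) (y - z) with f dual to x_1. *)
Require Import Defs.
From HB Require Import structures.
From mathcomp Require Import all_boot all_order all_algebra.
From mathcomp Require Import all_classical all_reals topology normedtype sequences.
From mathcomp Require Import derive zify lra.
Import Order.TTheory GRing.Theory Num.Theory.
Import numFieldNormedType.Exports.

Local Open Scope classical_set_scope.
Local Open Scope card_scope.
Local Open Scope ring_scope.

(** * Coordinates, continuity and compactness in finite dimension *)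

Definition linear_of {R : pzRingType} {V W : lmodType R} {f : V -> W}
    (linf : linear f) : {linear V -> W} :=
  HB.pack f (GRing.isLinear.Build R V W *:%R f linf).

Lemma linear_bound_continuous (R : realType) (V W : normedModType R)
    (f : V -> W) (C : R) :
  linear f -> (forall v, `|f v| <= C * `|v|) -> continuous f.
Proof.
move=> linf fC; pose f' : {linear V -> W} := linear_of linf.
have : continuous f' by apply/bounded_linear_continuous/linear_boundedP;
  near=> r => v; apply: (le_trans (fC v)); rewrite ler_wpM2r.
by [].
Unshelve. all: by end_near. Qed.

Lemma linear_sum_coord {R : realType} {V : vectType R} {W : lmodType R}
    (f : V -> W) (x : V) : linear f ->
  f x = \sum_i coord (vbasis {:V}) i x *: f (vbasis {:V})`_i.
Proof.
move=> linf; pose f' : {linear V -> W} := linear_of linf.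
rewrite -[f]/(f' : V -> W) {1}(coord_vbasis (memvf x)) linear_sum.
by apply: eq_bigr => i _; rewrite linearZ.
Qed.

Lemma ler_coord_mx_norm (R : realType) (m n : nat) (A : 'M[R]_(m, n)) i j :
  `|A i j| <= `|A|.
Proof.
rewrite [leRHS]/Num.norm /= mx_normrE.
exact: (le_bigmax _ (fun k => `|A k.1 k.2|) (i, j)).
Qed.

Section FiniteDimension.
Context {R : realType} {X : finDimBanachType R}.

Let d := \dim {:X}.
Let b := vbasis {:X}.

(** Row vectors carry the max norm, under which closed bounded sets are compact. This map transports
    that compactness to the norm of [X], to which the vector space structure is not tied. *)
Definition of_coords (v : 'rV[R]_d) : X := \sum_i v 0 i *: b`_i.

Lemma of_coords_linear : linear of_coords.
Proof.
move=> a u v; rewrite /of_coords scaler_sumr -big_split; apply: eq_bigr => i _.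
by rewrite !mxE scalerDl scalerA.
Qed.

HB.instance Definition _ :=
  GRing.isLinear.Build R 'rV[R]_d X *:%R of_coords of_coords_linear.

Lemma of_coordsK x : of_coords (\row_i coord b i x) = x.
Proof.
rewrite [RHS](coord_vbasis (memvf x)); apply: eq_bigr => i _.
by rewrite mxE.
Qed.

Lemma coord_of_coords i v : coord b i (of_coords v) = v 0 i.
Proof. by rewrite coord_sum_free // (basis_free (vbasisP _)). Qed.

Lemma of_coords_continuous : continuous of_coords.
Proof.
apply: (@linear_bound_continuous _ _ _ of_coords (\sum_(i < d) `|b`_i|)).
  exact: of_coords_linear.
move=> v; rewrite mulr_suml (le_trans (ler_norm_sum _ _ _))//.
by apply: ler_sum => i _; rewrite normrZ mulrC ler_wpM2l// ler_coord_mx_norm.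
Qed.

(* The norm of X attains a positive minimum on the compact unit sphere of
   the coordinate space. *)
Lemma coord_bounded : exists2 C : R, 0 <= C &
  forall v : 'rV[R]_d, `|v| <= C * `|of_coords v|.
Proof.
pose S := [set v : 'rV[R]_d | `|v| = 1].
(* An empty sphere, as in dimension 0, has no minimum to attain. Every vector is then 0 and the
   constant 0 works. *)
have [S0|/set0P S0] := eqVneq S set0.
  exists 0 => // v; rewrite mul0r; have [->|v0] := eqVneq v 0.
    by rewrite normr0.
  have : S (`|v|^-1 *: v) by rewrite /S/= normrZ normfV normr_id mulVf// normr_eq0.
  by rewrite S0.
have cS : compact S.
  apply: bounded_closed_compact.
    by exists 1; split; rewrite ?num_real// => x x1 v /= ->; rewrite ltW.
  apply: (@preimage_closed _ _ (fun v : 'rV[R]_d => `|v|) [set 1]).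
    by move=> v _; exact: norm_continuous.
  exact: closed_eq.
have cf : {within S, continuous (fun v => `|of_coords v|)}.
  apply: continuous_subspaceT => v.
  by apply: continuous_comp; [exact: of_coords_continuous|exact: norm_continuous].
have [c] := compact_EVT_min S0 cS cf.
rewrite inE /S/= => c1 cmin.
have m0 : 0 < `|of_coords c|.
  rewrite normr_gt0; apply/eqP => c0.
  suff c0' : c = 0 by move: c1; rewrite c0' normr0 => /esym/eqP; rewrite oner_eq0.
  by apply/rowP => i; rewrite -coord_of_coords c0 (linear0 (coord b i)) mxE.
exists `|of_coords c|^-1; first by rewrite invr_ge0.
move=> v; rewrite mulrC ler_pdivlMr//; have [->|v0] := eqVneq v 0.
  by rewrite normr0 mul0r.
have v0' : 0 < `|v| by rewrite normr_gt0.
have /cmin : `|v|^-1 *: v \in S.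
  by rewrite inE /S/= normrZ normfV normr_id mulVf// gt_eqF.
by rewrite linearZ normrZ normfV normr_id mulrC ler_pdivlMr// mulrC.
Qed.

(** Each coordinate of [x] is at most [C * |x|], so expanding [f x] in the basis gives a Lipschitz
    bound. *)
Lemma findim_linear_continuous (W : normedModType R) (f : X -> W) :
  linear f -> continuous f.
Proof.
move=> linf; have [C C0 normC] := coord_bounded.
apply: (@linear_bound_continuous _ _ _ _ (C * \sum_(i < d) `|f b`_i|)) => // x.
rewrite (linear_sum_coord f x linf) (le_trans (ler_norm_sum _ _ _))//.
rewrite mulrAC mulr_sumr; apply: ler_sum => i _.
rewrite normrZ ler_wpM2r//.
have := normC (\row_i coord b i x); rewrite of_coordsK; apply: le_trans.
apply: le_trans (ler_coord_mx_norm _ _ _ _ 0 i).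
by rewrite mxE.
Qed.

(** The ball is the continuous image of its set of coordinate vectors, which is closed by continuity
    and bounded by [coord_bounded]. *)
Lemma unit_ball_compact : compact (unit_ball X).
Proof.
have [C C0 normC] := coord_bounded.
have -> : unit_ball X = of_coords @` (of_coords @^-1` unit_ball X).
  apply/seteqP; split => [x x1|_ [v v1 <-]//].
  by exists (\row_i coord b i x); rewrite /= ?of_coordsK.
apply: continuous_compact.
  by apply: continuous_subspaceT; exact: of_coords_continuous.
apply: bounded_closed_compact.
  exists C; split; rewrite ?num_real// => r Cr v /= v1.
  by rewrite (le_trans (normC v))// (le_trans _ (ltW Cr))// ler_piMr.
apply: (@preimage_closed _ _ (fun v => `|of_coords v|) [set x | x <= 1]).
  move=> v _; apply: continuous_comp; first exact: of_coords_continuous.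
  exact: norm_continuous.
exact: closed_le.
Qed.

End FiniteDimension.

(** * Extreme subsets and Bauer's maximum principle *)

Definition extreme_subset (R : realType) (V : lmodType R) (K A : set V) :=
  A `<=` K /\ forall (x y z : V) (t : R), A x -> K y -> K z -> 0 < t < 1 ->
    x = t *: y + (1 - t) *: z -> A y /\ A z.

Definition convex_fun (R : realType) (V : lmodType R) (g : V -> R) :=
  forall (y z : V) (t : R), 0 < t < 1 ->
    g (t *: y + (1 - t) *: z) <= t * g y + (1 - t) * g z.

(** If a convex function is maximal at an inner point of a segment, it takes the same value at both
    ends, so the maximisers in [A] are again extreme in [K]. Compactness is kept, which lets the
    step be iterated. *)
Lemma extreme_subset_argmax (R : realType) (V : normedModType R)
    (K A : set V) (g : V -> R) :
  A !=set0 -> compact A -> extreme_subset R V K A ->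
  continuous g -> convex_fun R V g ->
  exists B, [/\ B `<=` A, B !=set0, compact B, extreme_subset R V K B &
    forall x y, B x -> A y -> g y <= g x].
Proof.
move=> A0 cA [AK extA] cg convg.
have [c] := compact_EVT_max A0 cA (continuous_subspaceT cg).
rewrite inE => Ac cmax.
have gle y : A y -> g y <= g c by move=> Ay; apply: cmax; rewrite inE.
exists (A `&` [set x | g c <= g x]); split.
- by move=> x [].
- by exists c; split => /=.
- apply: compact_closedI => //.
  apply: (@preimage_closed _ _ g [set r | g c <= r]).
    by move=> x _; exact: cg.
  exact: closed_ge.
- split=> [x [/AK]//|x y z t [Ax /= gx] Ky Kz t01 xE].
  have [Ay Az] := extA x y z t Ax Ky Kz t01 xE.
  have := convg y z t t01; rewrite -xE => /(le_trans gx) gc.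
  by move: t01 (gle y Ay) (gle z Az) => /andP[t0 t1] gy gz; split; split=> //=; nra.
- by move=> x y [_ /= gx] Ay; exact: le_trans (gle y Ay) gx.
Qed.

(** A nonzero vector of norm below 1 lies strictly between 0 and its normalisation. The vector 0 is
    set apart because it is extreme in the ball of the zero space. *)
Lemma ball_extreme_point_norm {R : realType} (Z : normedModType R) (x : Z) :
  ball_extreme_points Z x -> x != 0 -> `|x| = 1.
Proof.
move=> [x1 extx] x0; apply/eqP; rewrite eq_le; apply/andP; split=> //.
rewrite leNgt; apply/negP => xlt1.
have nx0 : 0 < `|x| by rewrite normr_gt0.
have [||||_ /esym/eqP] := extx (`|x|^-1 *: x) 0 `|x|; last by rewrite (negbTE x0).
- by rewrite /unit_ball/= normrZ normfV normr_id mulVf// gt_eqF.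
- by rewrite /unit_ball/= normr0.
- by rewrite nx0.
- by rewrite scaler0 addr0 scalerA mulfV ?scale1r// gt_eqF.
Qed.

Section FiniteDimensionalExtremePoints.
Context {R : realType} {X : finDimBanachType R}.

Let b := vbasis {:X}.

(** Passing to the maximisers of one coordinate makes it constant, and it stays constant on the
    smaller sets cut out by the later coordinates. *)
Lemma extreme_subset_coord_const (K : set X) (s : seq 'I_(\dim {:X})) (A : set X) :
  A !=set0 -> compact A -> extreme_subset R X K A ->
  exists B, [/\ B `<=` A, B !=set0, extreme_subset R X K B &
    forall i x y, i \in s -> B x -> B y -> coord b i x = coord b i y].
Proof.
elim: s A => [|i s IHs] A A0 cA extA; first by exists A; split.
have lin : linear (coord b i : X -> R^o) by move=> a u v; rewrite linearP.
have [||B [BA B0 cB extB Bmax]] :=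
  extreme_subset_argmax R X K A (coord b i) A0 cA extA.
- exact: (findim_linear_continuous _ _ lin).
- by move=> y z t _; rewrite linearD !linearZ.
have [C [CB C0 extC Cconst]] := IHs B B0 cB extB.
exists C; split => //; first exact: subset_trans CB BA.
move=> j x y; rewrite inE => /orP[/eqP-> Cx Cy|]; last exact: Cconst.
by apply/eqP; rewrite eq_le !Bmax//; by [exact: CB|exact/BA/CB].
Qed.

(* Bauer's maximum principle. Maximising the coordinates one after the other
   cuts the extreme subset [argmax g] of [K] down to a single point. *)
Lemma extreme_point_argmax (K : set X) (g : X -> R) :
  K !=set0 -> compact K -> continuous g -> convex_fun R X g ->
  exists2 e, extreme_points K e & forall x, K x -> g x <= g e.
Proof.
move=> K0 cK cg convg.
have extK : extreme_subset R X K K by split.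
have [A [AK A0 cA extA Amax]] :=
  extreme_subset_argmax R X K K g K0 cK extK cg convg.
have [B [BA [e Be] [BK extB] Bconst]] :=
  extreme_subset_coord_const K (enum 'I_(\dim {:X})) A A0 cA extA.
have Buniq x : B x -> x = e.
  move=> Bx; rewrite (coord_vbasis (memvf x)) [RHS](coord_vbasis (memvf e)).
  by apply: eq_bigr => i _; rewrite (Bconst i x e)// mem_enum.
exists e; last by move=> x Kx; apply: Amax => //; exact: BA.
split=> [|y z t Ky Kz t01 eE]; first exact: BK.
by have [By Bz] := extB e y z t Be Ky Kz t01 eE; split; exact: Buniq.
Qed.

Lemma unit_ball_linear_bound (W : normedModType R) (f : X -> W) (M : R) :
  linear f -> (forall e, ball_extreme_points X e -> `|f e| <= M) ->
  forall x, unit_ball X x -> `|f x| <= M.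
Proof.
move=> linf fM x x1.
have [|||e Ee emax] :=
  extreme_point_argmax (unit_ball X) (fun x => `|f x|) _ unit_ball_compact.
- by exists x.
- move=> v; apply: continuous_comp; last exact: norm_continuous.
  exact: findim_linear_continuous.
- move=> y z t /andP[t0 t1].
  pose f' : {linear X -> W} := linear_of linf.
  rewrite -[f]/(f' : X -> W) linearD !linearZ (le_trans (ler_normD _ _))//.
  by rewrite !normrZ !gtr0_norm// subr_gt0.
by rewrite (le_trans (emax x x1))// fM.
Qed.

(** This is the maximum principle with bound 0; it replaces the Krein-Milman theorem in showing that
    the extreme points span. *)
Lemma linear_eq0_extreme_points (W : normedModType R) (f : X -> W) :
  linear f -> (forall e, ball_extreme_points X e -> f e = 0) -> forall x, f x = 0.
Proof.
move=> linf fE x; pose f' : {linear X -> W} := linear_of linf.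
have [->|x0] := eqVneq x 0; first exact: (linear0 f').
have x1 : unit_ball X (`|x|^-1 *: x).
  by rewrite /unit_ball/= normrZ normfV normr_id mulVf ?normr_eq0.
have f0 e : ball_extreme_points X e -> `|f e| <= 0 by move=> /fE->; rewrite normr0.
have := unit_ball_linear_bound _ _ _ linf f0 _ x1.
rewrite -[f]/(f' : X -> W) linearZ normr_le0 scaler_eq0 invr_eq0 normr_eq0.
by rewrite (negbTE x0) => /eqP.
Qed.

End FiniteDimensionalExtremePoints.

(** * Operator norm, perturbations and rigidity of extreme contractions *)

Section Operators.
Context {R : realType} {X Y : normedModType R}.

Lemma ler_operator_norm (T : X -> Y) (x : X) :
  bounded_fun_norm T -> unit_ball X x -> `|T x| <= operator_norm T.
Proof.
move=> bT x1; apply: ub_le_sup; last by exists x.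
by have [M TM] := bT 1; exists M => _ [z z1 <-]; exact: TM.
Qed.

Lemma operator_unit_ballP (T : X -> Y) : linear T ->
  (forall x, unit_ball X x -> `|T x| <= 1) -> operator_unit_ball T.
Proof.
move=> linT T1; split; [split=> //|]; last first.
  apply: ge_sup; first by exists `|T 0|, 0 => //; rewrite /unit_ball/= normr0.
  by move=> _ [x x1 <-]; exact: T1.
pose T' : {linear X -> Y} := linear_of linT.
apply/(bounded_funP T')/ex_bound; exists 1; apply/nbhs_norm0P.
by exists 1 => //= x /= x1; apply: T1; exact: ltW.
Qed.

(** The point [a + e' *: b] lies on the segment from [a] to [a + e *: b], and the ball is convex.
    When [e <= 0], the bounds force [e' = e]. *)
Lemma unit_ball_shrink (a b : Y) (e e' : R) : `|a| <= 1 -> 0 <= e' <= e ->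
  `|a + e *: b| <= 1 -> `|a + e' *: b| <= 1.
Proof.
move=> a1 /andP[e'0 e'e] ae1.
have [e0|e0] := leP e 0.
  by have -> : e' = e by lra.
have -> : a + e' *: b = (e' / e) *: (a + e *: b) + (1 - e' / e) *: a.
  rewrite scalerDr scalerA divfK ?gt_eqF// scalerBl scale1r.
  by rewrite addrAC subrKC.
have t0 : 0 <= e' / e by rewrite divr_ge0// ltW.
have t1 : 0 <= 1 - e' / e by rewrite subr_ge0 ler_pdivrMr// mul1r.
move: (e' / e) t0 t1 => t t0 t1.
rewrite (le_trans (ler_normD _ _))// !normrZ !ger0_norm//; nra.
Qed.

End Operators.

(** A minimum of finitely many positive numbers is positive: this is how finiteness of the set of
    extreme points is exploited. *)
Lemma seq_uniform_eps (R : realType) (I : eqType) (s : seq I) (P : I -> R -> Prop) :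
  (forall i, i \in s -> exists2 e, 0 < e & P i e) ->
  (forall i e e', i \in s -> 0 <= e' <= e -> P i e -> P i e') ->
  exists2 e, 0 < e & forall i, i \in s -> P i e.
Proof.
elim: s => [|i s IHs] exP decP; first by exists 1.
have [||e e0 Pe] := IHs.
- by move=> j js; apply: exP; rewrite inE js orbT.
- by move=> j r r' js; apply: decP; rewrite inE js orbT.
have [r r0 Pr] := exP i (mem_head _ _).
have m0 : 0 < Num.min e r by rewrite lt_min e0.
exists (Num.min e r) => // j /[dup] jis; rewrite inE => /orP[/eqP ji|js].
  by apply: (decP j r) => //; rewrite ?ji// ltW//= ge_min lexx orbT.
by apply: (decP j e) (Pe j js) => //; rewrite ltW//= ge_min lexx.
Qed.

(** The admissible [e] may depend on [x]. Extreme points that do not attain the norm impose no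
    condition, since there [|T x| < 1] leaves room for any [S]. *)
Lemma extreme_contraction_rigid (R : realType) (X : finDimBanachType R)
    (Y : normedModType R) (T S : X -> Y) :
  polygonal X -> extreme_contraction T -> linear S ->
  (forall x, (norm_attainment_set T `&` ball_extreme_points X) x ->
    exists2 e : R, 0 < e & `|T x + e *: S x| <= 1 /\ `|T x - e *: S x| <= 1) ->
  forall x, S x = 0.
Proof.
move=> polyX [[[linT bT] T1] extT] linS Spert.
have T1' x : unit_ball X x -> `|T x| <= 1.
  by move=> x1; rewrite (le_trans (ler_operator_norm T x bT x1)).
have /finite_seqP[s Es] := polyX.
pose P x (e : R) := `|T x + e *: S x| <= 1 /\ `|T x - e *: S x| <= 1.
have T0 : T 0 = 0 := linear0 (linear_of linT).
have Es' x : x \in s -> ball_extreme_points X x by rewrite Es.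
have Eball x : x \in s -> unit_ball X x by move=> /Es'[].
have exP x : x \in s -> exists2 e, 0 < e & P x e.
  move=> xs; have Ex := Es' x xs.
  have [Mx|nMx] := pselect (norm_attainment_set T x); first exact: Spert.
  have Tx1 : `|T x| < 1.
    have [->|x0] := eqVneq x 0; first by rewrite T0 normr0.
    have nx1 := ball_extreme_point_norm _ _ Ex x0.
    rewrite (lt_le_trans _ T1)// lt_neqAle ler_operator_norm ?andbT//;
      last exact: Eball.
    by apply/negP => /eqP TxE; apply: nMx.
  (* The witness makes [e * |S x|] at most the slack [1 - |T x|]; the added 1 keeps the denominator
     positive when [S x = 0]. *)
  have den0 : 0 < `|S x| + 1 by rewrite ltr_wpDl.
  exists ((1 - `|T x|) / (`|S x| + 1)); first by rewrite divr_gt0 ?subr_gt0.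
  have eS : `|((1 - `|T x|) / (`|S x| + 1)) *: S x| <= 1 - `|T x|.
    have num0 : 0 <= 1 - `|T x| by rewrite subr_ge0 ltW.
    rewrite normrZ ger0_norm; last by rewrite divr_ge0// ltW.
    rewrite -mulrA ler_piMr// mulrC.
    by rewrite ler_pdivrMr// mul1r lerDl.
  split; first by rewrite (le_trans (ler_normD _ _))// -lerBrDl.
  by rewrite (le_trans (ler_normB _ _))// -lerBrDl.
have decP x e e' : x \in s -> 0 <= e' <= e -> P x e -> P x e'.
  move=> xs e'e [Pp Pm]; have Tx1 := T1' x (Eball x xs).
  split; first exact: unit_ball_shrink e'e Pp.
  by rewrite -scalerN; apply: unit_ball_shrink e'e _ => //; rewrite scalerN.
have [e e0 Pe] := seq_uniform_eps R X s P exP decP.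
have pert_ball (r : R) : (forall x, x \in s -> `|T x + r *: S x| <= 1) ->
    operator_unit_ball (T + r *: S).
  move=> Pr; have lin : linear (T + r *: S).
    move=> a u v; rewrite !fctE linT linS !scalerDr addrACA.
    by rewrite !scalerA mulrC.
  apply: (operator_unit_ballP _ lin).
  by apply: (unit_ball_linear_bound _ _ _ lin) => x; rewrite Es; exact: Pr.
(* [T] is the midpoint of [T + e *: S] and [T - e *: S], so extremality identifies both with [T]. *)
have [||||TS _] := extT (T + e *: S) (T + (- e) *: S) 2^-1.
- by apply: pert_ball => x /Pe[].
- by apply: pert_ball => x /Pe[]; rewrite scaleNr.
- by apply/andP; split; lra.
- have -> : 1 - 2^-1 = 2^-1 :> R by lra.
  rewrite -scalerDr addrACA -scalerDl subrr scale0r addr0 -mulr2n.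
  by rewrite -[T *+ 2]scaler_nat scalerA mulVf ?pnatr_eq0// scale1r.
move=> x; have /(congr1 (fun F => F x)) := TS.
rewrite !fctE => /eqP; rewrite -subr_eq0 addrAC subrr add0r.
by rewrite scaler_eq0 gt_eqF//= => /eqP.
Qed.

(** * Separating functionals and symmetric families *)

(** Subtracting the projection onto [U] kills [U] but not [v]. Some coordinate of the remainder of
    [v] is nonzero, and dividing by it gives the functional. *)
Lemma scalar_separation (K : fieldType) (V : vectType K) (U : {vspace V}) (v : V) :
  v \notin U ->
  exists f : V -> K, [/\ scalar f, f v = 1 & forall u, u \in U -> f u = 0].
Proof.
move=> vU; pose q u := u - projv U u.
have qU u : u \in U -> q u = 0 by move=> uU; rewrite /q projv_id// subrr.
have qv0 : q v != 0.
  by apply: contra vU; rewrite subr_eq0 => /eqP->; rewrite memv_proj.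
pose b := vbasis {:V}.
have [i ci0] : exists i, coord b i (q v) != 0.
  apply/existsP; apply: contraNT qv0; rewrite negb_exists => /forallP c0.
  rewrite (coord_vbasis (memvf (q v))) big1// => i _.
  by have := c0 i; rewrite negbK => /eqP ->; rewrite scale0r.
exists (fun u => (coord b i (q v))^-1 * coord b i (q u)); split.
- move=> a u w /=; have -> : q (a *: u + w) = a *: q u + q w.
    by rewrite /q linearP scalerBr opprD addrACA.
  by rewrite linearP mulrDr mulrCA.
- by rewrite mulVf.
- by move=> u /qU->; rewrite linear0 mulr0.
Qed.

Definition symmetric_seq (V : zmodType) (s : seq V) :=
  [/\ uniq s, 0 \notin s & forall x, x \in s -> - x \in s].

(** In characteristic 0 a nonzero [x] differs from [- x], so removing the antipodal pair drops
    exactly two entries and keeps the symmetry. *)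
Lemma symmetric_seq_rem (K : numFieldType) (V : lmodType K) (s : seq V) (x : V) :
  symmetric_seq V s -> x \in s -> exists r : seq V,
  [/\ symmetric_seq V r, size s = (size r).+2 &
    forall y, y \in s -> [\/ y = x, y = - x | y \in r]].
Proof.
move=> [us s0 symm] xs.
have x0 : x != 0 by apply: contraNneq s0 => <-.
have Nxx : - x != x.
  by rewrite eqr_oppLR -addr_eq0 -mulr2n -scaler_nat scaler_eq0 pnatr_eq0.
have memr y : (y \in rem (- x) (rem x s)) = [&& y != - x, y != x & y \in s].
  by rewrite (mem_rem_uniq _ (rem_uniq _ us)) !inE (mem_rem_uniq _ us) !inE.
have Nxs : - x \in rem x s by rewrite (mem_rem_uniq _ us) !inE Nxx symm.
have size_rem1 (u : seq V) (w : V) : w \in u -> size u = (size (rem w u)).+1.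
  by move=> wu; rewrite size_rem// prednK//; case: (u) wu.
exists (rem (- x) (rem x s)); split.
- split; first by rewrite !rem_uniq.
    by rewrite memr (negbTE s0) !andbF.
  move=> y; rewrite !memr => /and3P[yNx yx ys].
  by rewrite (inj_eq oppr_inj) yx eqr_oppLR yNx symm.
- by rewrite (size_rem1 _ _ xs) (size_rem1 _ _ Nxs).
- move=> y ys; have [->|yx] := eqVneq y x; first exact: Or31.
  have [->|yNx] := eqVneq y (- x); first exact: Or32.
  by apply: Or33; rewrite memr yNx yx.
Qed.

(** Each antipodal pair adds at most one dimension. The induction is on the size, because what
    remains after removing a pair need not be a tail of [s]. *)
Lemma dim_span_symmetric (K : numFieldType) (V : vectType K) (s : seq V) :
  symmetric_seq V s -> (2 * \dim <<s>> <= size s)%N.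
Proof.
have [m] := ubnP (size s); elim: m s => // m IHm [|x s] sm symm.
  by rewrite span_nil dimv0.
have [r [symr szr sr]] := symmetric_seq_rem _ _ _ _ symm (mem_head x s).
have IH : (2 * \dim <<r>> <= size r)%N.
  by apply: IHm => //; move: sm; rewrite szr => /ltnW.
have : (\dim <<x :: s>> <= (\dim <<r>>).+1)%N.
  apply: (@leq_trans (\dim (<[x]> + <<r>>))).
    apply/dimvS/span_subvP => y /sr[->|->|yr].
    - by apply: (subvP (addvSl _ _)); exact: memv_line.
    - by rewrite memvN; apply: (subvP (addvSl _ _)); exact: memv_line.
    - by apply: (subvP (addvSr _ _)); exact: memv_span.
  apply: (leq_trans (dimv_add_leqif _ _)).
  by rewrite dim_vline -add1n leq_add2r; case: (x != 0).
by rewrite szr => dimS; lia.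
Qed.

(** * Symmetry and segments of the ball, and the theorem *)

Lemma ball_extreme_pointsN (R : realType) (Z : normedModType R) (x : Z) :
  ball_extreme_points Z x -> ball_extreme_points Z (- x).
Proof.
move=> [x1 extx]; split; first by rewrite /unit_ball/= normrN.
move=> y z t y1 z1 t01 xE.
have [||//||yx zx] := extx (- y) (- z) t.
- by rewrite /unit_ball/= normrN.
- by rewrite /unit_ball/= normrN.
- by rewrite !scalerN -opprD -xE opprK.
by split; apply: oppr_inj; rewrite opprK.
Qed.

(** Adding [r *: (y - z)] slides the point along the segment: the weight [t] becomes [t + r], which
    the bound on [r] keeps in [0, 1]. *)
Lemma unit_ball_segment (R : realType) (Y : normedModType R) (y z : Y) (t r : R) :
  `|y| <= 1 -> `|z| <= 1 -> 0 < t < 1 -> `|r| <= Num.min t (1 - t) ->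
  `|t *: y + (1 - t) *: z + r *: (y - z)| <= 1.
Proof.
move=> y1 z1 /andP[t0 t1]; rewrite le_min !ler_norml.
move=> /andP[/andP[r1 r2] /andP[r3 r4]].
have -> : t *: y + (1 - t) *: z + r *: (y - z) =
    (t + r) *: y + (1 - (t + r)) *: z.
  by rewrite scalerBr addrACA -scalerDl -scalerBl; congr (_ + _ *: _); lra.
have p0 : 0 <= t + r by lra.
have p1 : 0 <= 1 - (t + r) by lra.
move: (t + r) p0 p1 => p p0 p1.
rewrite (le_trans (ler_normD _ _))// !normrZ !ger0_norm//; nra.
Qed.

Lemma scalar_rank_one_linear (R : realType) (X Y : lmodType R) (f : X -> R) (y : Y) :
  scalar f -> linear (fun x => f x *: y).
Proof. by move=> linf a u v; rewrite linf scalerDl scalerA. Qed.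

Theorem theorem2p2 (R : realType) (n : nat) (X : finDimBanachType R)
    (Y : normedModType R) (T : X -> Y) (dimX : \dim {:X} = n)
    (polyX : polygonal X) (extT : extreme_contraction T) :
  linear_span (norm_attainment_set T `&` ball_extreme_points X) = setT /\
  ((norm_attainment_set T `&` ball_extreme_points X) #= `I_(2 * n)%N ->
   T @` (norm_attainment_set T `&` ball_extreme_points X)
     `<=` ball_extreme_points Y).
Proof.
set A := _ `&` _.
have [[[linT bT] T1] _] := extT.
have rigid := extreme_contraction_rigid R X Y T _ polyX extT.
have Tball x : unit_ball X x -> `|T x| <= 1.
  by move=> x1; rewrite (le_trans (ler_operator_norm T x bT x1)).
have finA : finite_set A by apply: sub_finite_set polyX => x [].
have spanA (s : seq X) : A = [set` s] -> <<s>>%VS = fullv.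
  move=> As; apply/eqP; rewrite eqEsubv subvf/=; apply/subvP => v _.
  apply: contraT => /scalar_separation[f [linf fv f0]].
  have f0A x : A x -> f x = 0 by rewrite As => /memv_span/f0.
  (* The operator [f(.) y] vanishes on [A], so rigidity applies with [e = 1]; its value at [v] is
     [y]. *)
  have Y0 (y : Y) : y = 0.
    have := rigid _ (scalar_rank_one_linear _ _ _ f y linf).
    move=> /(_ _ v); rewrite fv scale1r; apply=> x [Mx Ex].
    exists 1 => //; rewrite f0A// scale0r scaler0 addr0 subr0.
    by have [x1 _] := Ex; split; exact: Tball.
  (* With Y = 0 every unit vector attains the norm, so f vanishes on all
     extreme points. *)
  have linf' : linear (f : X -> R^o) by [].
  have f00 : f 0 = 0 by apply: f0; rewrite mem0v.
  have fE e : ball_extreme_points X e -> (f : X -> R^o) e = 0.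
    move=> Ee; have [->//|e0] := eqVneq e 0.
    apply: f0A; split=> //; split; first exact: ball_extreme_point_norm Ee e0.
    apply/eqP; rewrite eq_le ler_operator_norm//=; last by case: Ee.
    apply: ge_sup; first by exists `|T e|, e => //; case: Ee.
    by move=> _ [z _ <-]; rewrite (Y0 (T z)) (Y0 (T e)).
  have := linear_eq0_extreme_points _ _ linf' fE v; rewrite fv => /eqP.
  by rewrite oner_eq0.
split.
  rewrite -subTset => v _.
  have /finite_seqP[s As] := finA.
  by exists s; [rewrite As|rewrite (spanA s As) memvf].
move=> cardA _ [x0 Ax0 <-].
pose s : seq X := finmap.enum_fset (fset_set A).
have As : A = [set` s] by rewrite fset_setK.
have Ain x : A x <-> x \in s by rewrite As.
have TN x : T (- x) = - T x := linearN (linear_of linT) x.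
have symm_s : symmetric_seq X s.
  split; first exact: finmap.fset_uniq.
    apply/negP => /Ain[[]]; rewrite /unit_sphere/= normr0 => /esym/eqP.
    by rewrite oner_eq0.
  move=> x /Ain[[x1 xM] xE]; apply/Ain; split; last exact: ball_extreme_pointsN.
  by split; [rewrite /unit_sphere/= normrN|rewrite TN normrN].
have size_s : size s = (2 * n)%N by exact: card_fset_set.
have /Ain x0s := Ax0.
have [r [symr szr sr]] := symmetric_seq_rem _ _ _ _ symm_s x0s.
(* Otherwise the [2n - 2] entries of [r] would span [X], whereas their symmetry limits the dimension
   of their span to [n - 1]. *)
have x0r : x0 \notin <<r>>%VS.
  apply/negP => x0r.
  have dr : (2 * \dim <<r>>%VS <= size r)%N := dim_span_symmetric _ _ _ symr.
  have {}szr : (2 * n = (size r).+2)%N by rewrite -size_s.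
  have : (\dim <<s>> <= \dim <<r>>)%N.
    apply/dimvS/span_subvP => y /sr[->//|->|yr]; first by rewrite memvN.
    exact: memv_span.
  by rewrite (spanA s As) dimX; lia.
have [f [linf fx0 f0]] := scalar_separation _ _ _ _ x0r.
have x0B : unit_ball X x0 by have [_ []] := Ax0.
split; first exact: Tball.
move=> y z t y1 z1 t01 TxE.
have e0 : 0 < Num.min t (1 - t) by rewrite lt_min; apply/andP; split; lra.
have seg (q : R) : `|q| <= Num.min t (1 - t) -> `|T x0 + q *: (y - z)| <= 1.
  by rewrite TxE; exact: unit_ball_segment.
have norm_e : `|Num.min t (1 - t)| <= Num.min t (1 - t) by rewrite gtr0_norm.
have fN x : f (- x) = - f x.
  by rewrite -scaleN1r -[_ *: x]addr0 linf (f0 0) ?mem0v// addr0 mulN1r.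
have := rigid _ (scalar_rank_one_linear _ _ _ f (y - z) linf).
move=> /(_ _ x0); rewrite fx0 scale1r => yz.
have {}yz : y = z.
  apply/eqP; rewrite -subr_eq0; apply/eqP; apply: yz => x.
  (* At [x0] the perturbation slides [T x0] along its segment, at [- x0] it does the same up to
     sign, and on [r] it vanishes with [f]. *)
  move=> /[dup] -[_ [x1 _]] /Ain/sr[->|->|xr]; exists (Num.min t (1 - t)) => //.
  - by rewrite fx0 scale1r -scaleNr; split; apply: seg; rewrite ?normrN.
  - rewrite TN fN fx0 scaleN1r scalerN.
    by split; rewrite -normrN opprD !opprK -?scaleNr; apply: seg; rewrite ?normrN.
  - rewrite f0 ?memv_span// scale0r scaler0 addr0 subr0.
    by split; exact: Tball.
suff -> : T x0 = z by rewrite yz.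
by rewrite TxE yz -scalerDl addrC subrK scale1r.
Qed.
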